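(* Let $X=\{x_1,\ldots,x_N\}$ and $Y=\{y_1,\ldots,y_N\}$ be two point clouds of the same size. Let $U_1$ be an orthogonal transformation on the point space of $X$ and let $X_{U_1}=\{U_1x_1,\ldots,U_1x_N\}$ be the point cloud with each point in $X$ transformed using $U_1$. Similarly, let $U_2$ be an orthogonal transformation on the point space of $Y$ and let $Y_{U_2}=\{U_2y_1,\ldots,U_2y_N\}$ be the point cloud with each point in $Y$ transformed using $U_2$. Then $\mathrm{LNSA}^{\mathrm{metric}}(X,Y)=\mathrm{LNSA}^{\mathrm{metric}}(X_{U_1},Y_{U_2})$.
   Context: A point cloud is a set $X=\{x_1,\ldots,x_N\}\subseteq\mathbb{R}^n$, with points indexed by $1,\ldots,N$; the point space of $X$ is $\mathbb{R}^n$. $d(\cdot,\cdot)$ is Euclidean distance. Let $k$ be the number of nearest neighbours considered. For an index $i$, $kNN_X(i)=(i_1,\ldots,i_k)$ means that the $k$ nearest neighbours of $x_i$ in $X$ are $(x_{i_1},\ldots,x_{i_k})$. For any $k$-tuple of indices $(i_1,\ldots,i_k)$, the approximate dimensionality of $x_i$ is $$\mathrm{AD}_X(i,(i_1,\ldots,i_k))=-\left(\frac1k\sum_{j=1}^k\log\frac{d(x_i,x_{i_j})}{d(x_i,x_{i_k})}\right)^{-1}.$$ Set $\mathrm{lid}(i,X)=\mathrm{AD}_X(i,kNN_X(i))$ and, for point clouds $X,Y$ of the same size $N$ (possibly in different dimensions), $\overline{\mathrm{lid}}_X(i,Y)=\mathrm{AD}_Y(i,kNN_X(i))$. Define $$\mathrm{LNSA}_Y(X)=\frac1N\sum_{i=1}^N\left(\mathrm{lid}(i,Y)^{-1}-\overline{\mathrm{lid}}_Y(i,X)^{-1}\right)^2,\qquad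 \mathrm{LNSA}^{\mathrm{metric}}(X,Y)=\mathrm{LNSA}_X(Y)+\mathrm{LNSA}_Y(X).$$ *)

(* Defs.v *)
From mathcomp Require Import all_boot all_order all_algebra.
From mathcomp Require Import reals exp.

Set Implicit Arguments.
Unset Strict Implicit.
Unset Printing Implicit Defensive.

Import Order.TTheory GRing.Theory Num.Theory.
Local Open Scope ring_scope.

Definition dotp (R : realType) (n : nat) (u v : 'cV[R]_n) : R :=
  \sum_(a < n) u a 0 * v a 0.

(* The norm that MathComp-Analysis puts on matrices is the sup norm, so the
   Euclidean distance is spelled out. *)
Definition dist (R : realType) (n : nat) (u v : 'cV[R]_n) : R :=
  Num.sqrt (\sum_(a < n) (u a 0 - v a 0) ^+ 2).

Definition orthogonal_transformation (R : realType) (n : nat)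
    (U : {linear 'cV[R]_n -> 'cV[R]_n}) : Prop :=
  forall u v : 'cV[R]_n, dotp (U u) (U v) = dotp u v.

Definition point_cloud (R : realType) (N n : nat) : Type := 'I_N -> 'cV[R]_n.

(* All indices other than [i], by increasing distance to [X i]. [sort] is
   stable and [enum 'I_N] is increasing, so that equidistant points are
   ordered by index. *)
Definition neighbours (R : realType) (N n : nat) (X : point_cloud R N n)
    (i : 'I_N) : seq 'I_N :=
  sort (fun a b => dist (X i) (X a) <= dist (X i) (X b))
       [seq j <- enum 'I_N | j != i].

(* [neighbours X i] has size N - 1, so the default value of [nth] is never used
   when k < N. *)
Definition kNN (R : realType) (N n k : nat) (X : point_cloud R N n)
    (i : 'I_N) : k.-tuple 'I_N :=
  [tuple nth i (neighbours X i) j | j < k].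

(* For 0 < k, [last i t] is the k-th entry of [t]. *)
Definition AD (R : realType) (N n k : nat) (X : point_cloud R N n) (i : 'I_N)
    (t : k.-tuple 'I_N) : R :=
  - (k%:R^-1 * \sum_(j < k) ln (dist (X i) (X (tnth t j)) /
                                dist (X i) (X (last i t))))^-1.

Definition lid (R : realType) (N n k : nat) (i : 'I_N)
    (X : point_cloud R N n) : R :=
  AD X i (kNN k X i).

(* [lid_bar k X i Y] is AD_Y(i, kNN_X(i)): the neighbours are those in [X], the
   distances are those in [Y]. *)
Definition lid_bar (R : realType) (N n m k : nat) (X : point_cloud R N n)
    (i : 'I_N) (Y : point_cloud R N m) : R :=
  AD Y i (kNN k X i).

(* [LNSA k Y X] is LNSA_Y(X): the subscript comes first. If the mean of the
   logarithms in [AD] is 0, then 0^-1 = 0 makes the inverse of the (infinite)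
   approximate dimensionality equal to 0, as expected. *)
Definition LNSA (R : realType) (N n m k : nat) (Y : point_cloud R N m)
    (X : point_cloud R N n) : R :=
  N%:R^-1 * \sum_(i < N) ((lid k i Y)^-1 - (lid_bar k Y i X)^-1) ^+ 2.

Definition LNSA_metric (R : realType) (N n m k : nat) (X : point_cloud R N n)
    (Y : point_cloud R N m) : R :=
  LNSA k X Y + LNSA k Y X.

(* Main.v *)
Require Import Defs.
From mathcomp Require Import all_boot all_order all_algebra.
From mathcomp Require Import reals exp.

Set Implicit Arguments.
Unset Strict Implicit.
Unset Printing Implicit Defensive.

Import Order.TTheory GRing.Theory Num.Theory.
Local Open Scope ring_scope.

(** [LNSA] sees a cloud only through its pairwise distances: they determine the order of the
    neighbours and the ratios inside [AD]. A linear map preserving [dotp] preserves distances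
    ([dist_orthogonal]), and [eq_dist_LNSA] concludes. *)

Lemma eq_sort (T : Type) (leT leT' : rel T) :
  leT =2 leT' -> sort leT =1 sort leT'.
Proof.
(* Sorting commutes with maps that respect the relations; here the map is [id]. *)
move=> eq_le s; have /(_ s) := @map_sort _ _ id leT' leT eq_le.
by rewrite !map_id => ->.
Qed.

Lemma dist_dotp (R : realType) (n : nat) (u v : 'cV[R]_n) :
  dist u v = Num.sqrt (dotp (u - v) (u - v)).
Proof. by congr Num.sqrt; apply: eq_bigr => a _; rewrite !mxE -expr2. Qed.

Lemma dist_orthogonal (R : realType) (n : nat)
    (U : {linear 'cV[R]_n -> 'cV[R]_n}) (hU : orthogonal_transformation U)
    (u v : 'cV[R]_n) :
  dist (U u) (U v) = dist u v.
Proof. by rewrite !dist_dotp -linearB hU. Qed.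

Section DistanceInvariance.
Variables (R : realType) (N n n' k : nat).
Variables (X : point_cloud R N n) (X' : point_cloud R N n').
Hypothesis eqX : forall i j, dist (X' i) (X' j) = dist (X i) (X j).

(** Equal distances make the two comparisons agree everywhere, ties included, so sorting the same
    list of indices gives the very same sequence. *)
Lemma eq_dist_kNN (i : 'I_N) : kNN k X' i = kNN k X i.
Proof.
have eq_nb : neighbours X' i = neighbours X i.
  by apply: eq_sort => a b; rewrite !eqX.
by apply: eq_from_tnth => j; rewrite !tnth_mktuple eq_nb.
Qed.

Lemma eq_dist_AD (i : 'I_N) (t : k.-tuple 'I_N) : AD X' i t = AD X i t.
Proof.
by rewrite /AD; under eq_bigr do rewrite !eqX.
Qed.

End DistanceInvariance.

(** The neighbours always come from [Y], but [lid_bar] measures them in [X]; hence a hypothesis on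
    each cloud. *)
Lemma eq_dist_LNSA (R : realType) (N n n' m m' k : nat)
    (X : point_cloud R N n) (X' : point_cloud R N n')
    (Y : point_cloud R N m) (Y' : point_cloud R N m')
    (eqX : forall i j, dist (X' i) (X' j) = dist (X i) (X j))
    (eqY : forall i j, dist (Y' i) (Y' j) = dist (Y i) (Y j)) :
  LNSA k Y' X' = LNSA k Y X.
Proof.
congr (_ * _); apply: eq_bigr => i _.
by rewrite /lid /lid_bar (eq_dist_kNN k eqY) (eq_dist_AD eqY) (eq_dist_AD eqX).
Qed.

Theorem lemmaE5 (R : realType) (N n m k : nat) (hk0 : (0 < k)%N)
    (hkN : (k < N)%N) (X : point_cloud R N n) (Y : point_cloud R N m)
    (U1 : {linear 'cV[R]_n -> 'cV[R]_n}) (U2 : {linear 'cV[R]_m -> 'cV[R]_m})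
    (hU1 : orthogonal_transformation U1) (hU2 : orthogonal_transformation U2) :
  LNSA_metric k X Y =
  LNSA_metric k (fun i : 'I_N => U1 (X i)) (fun i : 'I_N => U2 (Y i)).
Proof.
(* The two summands exchange the roles of [X] and [Y], so one lemma serves for both. *)
by symmetry; congr (_ + _); apply: eq_dist_LNSA => i j; exact: dist_orthogonal.
Qed.
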